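(* Let $k\ge 2$ be a fixed integer and let $\vec{s}=(s_{i,j})_{0\le i<j\le k-1}$ be a vector of positive integers, with $p=\sum_{0\le i<j\le k-1}(s_{i,j}-1)$. (1) Let $n\geq 1$ and suppose that $\mathcal{C}\subseteq \{0,1,\dots,k-1\}^n$ is a code such that for every pair $0\le i<j\le k-1$, $\mathcal{C}$ does not $(i,j)$-shatter any coordinate set $S\subseteq\{1,\dots,n\}$ of size $s_{i,j}$. Then $$|\mathcal{C}|\le \sum_{0\le \alpha_{i,j}\le s_{i,j}-1}\binom{n}{\alpha_{0,1},\alpha_{0,2},\ldots,\alpha_{k-2,k-1},\,n-\sum_{0\le i<j\le k-1}\alpha_{i,j}} = O(n^p),$$ where the sum is over all choices of integers $\alpha_{i,j}$ ($0\le i<j\le k-1$) with $0\le\alpha_{i,j}\le s_{i,j}-1$ for every pair $i<j$. (2) On the other hand, when $p$ is fixed and $n\to\infty$, there exist codes $\mathcal{C}\subseteq\{0,1,\dots,k-1\}^n$ such that for every pair $0\le i<j\le k-1$ the code $\mathcal{C}$ does not $(i,j)$-shatter any coordinate set of size $s_{i,j}$, and $$|\mathcal{C}|=\Omega(n^p).$$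
   Context: A code $\mathcal{C}\subseteq\{0,1,\dots,k-1\}^n$ is a set of vectors (codewords) $\mathbf{c}=(c_1,\dots,c_n)$, viewed also as functions from $\{1,\dots,n\}$ to $\{0,\dots,k-1\}$. For $S\subseteq\{1,\dots,n\}$, $\mathcal{C}\vert_S=\{\mathbf{c}\vert_S : \mathbf{c}\in\mathcal{C}\}$ denotes the projection (restriction) of $\mathcal{C}$ to $S$. For $i<j$ in $\{0,\dots,k-1\}$, $\mathcal{C}$ is said to $(i,j)$-shatter $S$ if $\mathcal{C}\vert_S$ contains all $2^{|S|}$ functions from $S$ to $\{i,j\}$. The multinomial coefficient $\binom{n}{a_1,\dots,a_m}$ with $\sum a_\ell=n$ is $\frac{n!}{a_1!\cdots a_m!}$, and is $0$ if some $a_\ell$ is negative. The constants implied by $O$ and $\Omega$ may depend on $k$ and $\vec{s}$ but not on $n$; the asymptotics are as $n\to\infty$ with $k$ and $\vec{s}$ fixed. *)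

(* Defs.v *)
From mathcomp Require Import all_boot all_order all_algebra.
From mathcomp Require Import classical_sets filter reals topology normedtype landau.
Export numFieldNormedType.Exports.

Set Implicit Arguments.
Unset Strict Implicit.
Unset Printing Implicit Defensive.

(* Coordinates {1, ..., n} are indexed by 'I_n = {0, ..., n - 1}. *)
Definition code (k n : nat) := {set {ffun 'I_n -> 'I_k}}.

Definition pairs (k : nat) : finType := {e : 'I_k * 'I_k | e.1 < e.2}.

Definition restriction (k n : nat) (S : {set 'I_n}) (c : {ffun 'I_n -> 'I_k}) :
  {ffun {x : 'I_n | x \in S} -> 'I_k} := [ffun x => c (val x)].

Definition projection (k n : nat) (C : code k n) (S : {set 'I_n}) :
  {set {ffun {x : 'I_n | x \in S} -> 'I_k}} := [set restriction S c | c in C].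

Definition shatters (k n : nat) (C : code k n) (i j : 'I_k) (S : {set 'I_n}) :=
  forall f : {ffun {x : 'I_n | x \in S} -> 'I_k},
    (forall x, f x \in [set i; j]) -> f \in projection C S.

Definition shatter_free (k : nat) (s : pairs k -> nat) (n : nat) (C : code k n) :=
  forall (e : pairs k) (S : {set 'I_n}),
    #|S| = s e -> ~ shatters C (val e).1 (val e).2 S.

(* Meant for entries summing to n, in which case the division is exact.
   Entries are integers so that the subtraction in [multinomial_bound] is not
   truncated. *)
Definition multinomial (n : nat) (a : seq int) : nat :=
  if all (fun z : int => (0 <= z)%R) a
  then n`! %/ \prod_(z <- a) (absz z)`! else 0.

(* As every s e is positive, alpha e : 'I_(s e) says 0 <= alpha e <= s e - 1. *)
Definition multinomial_bound (k : nat) (s : pairs k -> nat) (n : nat) : nat :=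
  \sum_(alpha : {dffun forall e : pairs k, 'I_(s e)})
    multinomial n
      (rcons [seq Posz (alpha e) | e : pairs k]
             (Posz n - \sum_(e : pairs k) Posz (alpha e))%R).

(* Main.v *)
(* Upper bound (Pajor's form of the Sauer-Shelah argument): |C| is at most the
   number of disjoint families (A_e), indexed by the pairs e = (i, j), such that
   C shatters each A_e for e. By induction on n: a set of m letters that can
   fill the first coordinate of a given word satisfies m <= 1 + 'C(m, 2), so |C|
   is at most the size of the code with that coordinate deleted plus, for each
   e, the number of words that extend by both letters of e; for the latter the
   deleted coordinate can be added to A_e. If C is shatter-free then
   |A_e| < s e, and the families with given sizes are counted by a multinomial
   coefficient, which is at most n^p.

   Lower bound: split the coordinates into p + 1 slots of about n / (p + 1)
   coordinates, with s e - 1 slots devoted to each pair e = (i, j) and one slot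
   held constant. A word takes the value i on a slot of e = (i, j), except for
   the value j at one freely chosen position. A set shattered for e lies in the
   slots of e, and the all-j pattern on it forces at most one element per slot,
   hence fewer than s e elements. *)
Require Import Defs.
From mathcomp Require Import all_boot all_order all_algebra.
From mathcomp Require Import classical_sets filter reals topology normedtype landau.
From mathcomp Require Import boolp zify.
Import GRing.Theory Num.Theory.

(** * Words split into a first letter and a tail *)

Section FunctionCons.
Context {T : finType} {n : nat}.
Implicit Types (a : T) (g : {ffun 'I_n -> T}).

Definition fcons a g : {ffun 'I_n.+1 -> T} :=
  [ffun x => oapp g a (unlift ord0 x)].

Lemma fcons0 a g : fcons a g ord0 = a.
Proof. by rewrite ffunE unlift_none. Qed.

Lemma fconsS a g x : fcons a g (lift ord0 x) = g x.
Proof. by rewrite ffunE liftK. Qed.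

Lemma fcons_bij : bijective (fun u => fcons u.1 u.2).
Proof.
exists (fun f : {ffun 'I_n.+1 -> T} =>
  (f ord0, [ffun x => f (lift ord0 x)])) => [[a g]|f] /=.
  by rewrite fcons0; congr pair; apply/ffunP => x; rewrite ffunE fconsS.
apply/ffunP => x; case: (unliftP ord0 x) => [y|] ->; last by rewrite fcons0.
by rewrite fconsS ffunE.
Qed.

Lemma card_fcons (A : {set {ffun 'I_n.+1 -> T}}) :
  #|A| = \sum_a \sum_g (fcons a g \in A).
Proof.
rewrite pair_big -sum1_card (reindex _ (onW_bij _ fcons_bij)).
by rewrite big_mkcond; apply: eq_bigr => u _; case: ifP.
Qed.

Lemma card_fcons_fiber a g t :
  #|fcons a g @^-1: [set t]| = (a == t) + #|g @^-1: [set t]|.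
Proof.
rewrite -!sum1dep_card big_mkcond big_ord_recl fcons0 /= [in RHS]big_mkcond /=.
congr addn; first by rewrite inE; case: ifP.
by apply: eq_bigr => x _; rewrite fconsS.
Qed.

End FunctionCons.

(** Sort the words by first letter [t]: the tails have the sizes [a] with [a t] lowered by one, so
    by induction they contribute at most [a t] times the factorial of the shorter length, and the
    [a t] sum to the full length. Sizes with a wrong sum give an empty set. *)
Lemma card_fibers_fact (T : finType) (n : nat) (a : T -> nat) :
  #|[set g : {ffun 'I_n -> T} | [forall t, #|g @^-1: [set t]| == a t]]|
    * \prod_t (a t)`! <= n`!.
Proof.
elim: n a => [|n IHn] a.
  have [->|[g]] := set_0Vmem [set g : {ffun 'I_0 -> T} |
      [forall t, #|g @^-1: [set t]| == a t]]; first by rewrite cards0.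
  rewrite inE => /forallP ga.
  rewrite big1 ?muln1 => [|t _]; last first.
    rewrite -(eqP (ga t)); suff -> : g @^-1: [set t] = finset.set0 by rewrite cards0.
    by apply/setP => -[].
  by apply: leq_trans (max_card _) _; rewrite card_ffun card_ord expn0.
set A := [set _ | _].
have [->|[g0]] := set_0Vmem A; first by rewrite cards0.
rewrite inE => /forallP g0a.
have sum_a : \sum_t a t = n.+1.
  under eq_bigr do rewrite -(eqP (g0a _)) -sum1_card.
  rewrite -[RHS]card_ord -sum1_card (partition_big g0 xpredT) //=.
  by apply: eq_bigr => t _; apply: eq_bigl => x; rewrite !inE.
rewrite card_fcons big_distrl /= factS -[X in _ <= X * _]sum_a big_distrl /=.
apply: leq_sum => t _.
case a_t: (a t) => [|b].
  rewrite big1 // => g _; rewrite inE; case: forallP => // /(_ t).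
  by rewrite card_fcons_fiber eqxx a_t.
pose a' u := if u == t then b else a u.
have -> : \prod_u (a u)`! = b.+1 * \prod_u (a' u)`!.
  rewrite (bigD1 t) // [in RHS](bigD1 t) //= a_t /a' eqxx factS mulnA.
  by congr muln; apply: eq_bigr => u /negPf ->.
rewrite mulnCA leq_mul2l; apply/orP; right; apply: leq_trans (IHn a').
rewrite leq_mul2r -sum1_card [leqRHS]big_mkcond; apply/orP; right.
apply: leq_sum => g _; rewrite !inE.
case: forallP => // gt; case: forallP => // -[] u.
have := gt u; rewrite card_fcons_fiber /a' [u == t]eq_sym.
by case: (t =P u) => // <-; rewrite a_t add1n eqSS.
Qed.

(** The pairs formed by the least letter of [A] and each other letter are already [#|A| - 1] in
    number. *)
Lemma card_leq_pairs (k : nat) (A : {set 'I_k}) :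
  #|A| <= (A != finset.set0) +
    \sum_(e : pairs k) (((val e).1 \in A) && ((val e).2 \in A)).
Proof.
have [->|[x0 x0A]] := set_0Vmem A; first by rewrite cards0.
have -> : A != finset.set0 by apply/set0Pn; exists x0.
pose i := [arg min_(x < x0 in A) val x].
have [iA imin] : i \in A /\ forall j, j \in A -> i <= j.
  by rewrite /i; case: arg_minnP.
rewrite (cardsD1 i) iA leq_add2l.
have lt_i j : j \in A :\ i -> i < j.
  rewrite !inE => /andP[ji jA]; rewrite ltn_neqAle imin // andbT.
  by rewrite eq_sym.
rewrite -big_mkcond sum1_card.
pose P := [pred e : pairs k | ((val e).1 \in A) && ((val e).2 \in A)].
apply: (@leq_trans #|[set (val e).2 | e in P]|); last exact: leq_imset_card.
apply/subset_leq_card/fintype.subsetP => j jA; apply/imsetP.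
exists (exist _ (i, j) (lt_i _ jA) : pairs k) => //.
by rewrite inE /= iA; move: jA; rewrite inE => /andP[].
Qed.

(** * Upper bound: codes against shattered families *)

Section PairShattering.
Context {k : nat}.
Implicit Types (i j : 'I_k) (e : pairs k).

Lemma shattersP n (C : code k n) i j (S : {set 'I_n}) :
  shatters C i j S <->
  (forall f : 'I_n -> 'I_k, (forall x, x \in S -> f x \in [set i; j]) ->
     exists2 c, c \in C & {in S, c =1 f}).
Proof.
split=> [shC f fij|shC f fij].
  have /imsetP[c cC /ffunP cf] : restriction S [ffun x => f x] \in projection C S.
    by apply: shC => x; rewrite !ffunE; apply/fij/valP.
  by exists c => // x xS; have := cf (exist _ x xS); rewrite !ffunE.
have [x|c cC cf] := shC (fun x => oapp f i (insub x)).
  by case: insubP => [u _ _ _|_ _] /=; rewrite ?fij // !inE eqxx.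
apply/imsetP; exists c => //; apply/ffunP => x; rewrite ffunE.
by rewrite cf ?(valK x) ?(valP x).
Qed.

(* An element of [shattered_families C] encodes the disjoint family of sets
   [A_e = g @^-1: [set Some e]], each of them shattered by [C] for the pair [e]. *)
Definition shattered_families {n} (C : code k n) :
    {set {ffun 'I_n -> option (pairs k)}} :=
  [set g : {ffun 'I_n -> option (pairs k)} | `[< forall e,
     shatters C (val e).1 (val e).2 (g @^-1: [set Some e]) >]].

Definition deletion {n} (C : code k n.+1) : code k n :=
  [set c | [exists a, fcons a c \in C]].

Definition double_deletion {n} (C : code k n.+1) e : code k n :=
  [set c | (fcons (val e).1 c \in C) && (fcons (val e).2 c \in C)].

(** Apply [card_leq_pairs] to the letters that complete a given tail to a codeword, and sum over the
    tails. *)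
Lemma leq_card_deletion n (C : code k n.+1) :
  #|C| <= #|deletion C| + \sum_e #|double_deletion C e|.
Proof.
rewrite card_fcons exchange_big /=.
under [X in _ + X]eq_bigr do rewrite -sum1_card big_mkcond.
rewrite [X in _ <= _ + X]exchange_big -[#|deletion C|]sum1_card.
rewrite [X in X + _]big_mkcond /= -big_split /=.
apply: leq_sum => c _ /=.
have -> : \sum_a (fcons a c \in C) = #|[set a | fcons a c \in C]|.
  by rewrite -sum1dep_card [RHS]big_mkcond.
apply: leq_trans (card_leq_pairs _ _) _.
apply: leq_add; last by apply: leq_sum => e _; rewrite !inE.
rewrite inE; case: eqP => // /eqP /set0Pn[a]; rewrite inE => aC.
by case: ifPn => // /existsP[]; exists a.
Qed.

Lemma deletion_families n (C : code k n.+1) g :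
  g \in shattered_families (deletion C) ->
  fcons None g \in shattered_families C.
Proof.
rewrite !inE => /asboolP shg; apply/asboolP => e.
apply/shattersP => f fe; have /shattersP := shg e.
case/(_ (fun x => f (lift ord0 x))) => [x|c].
  by rewrite inE => gx; apply: fe; rewrite inE fconsS.
rewrite inE => /existsP[a acC] cf; exists (fcons a c) => // x.
rewrite !inE; case: (unliftP ord0 x) => [y|] ->; last by rewrite fcons0.
by rewrite !fconsS => gy; apply: cf; rewrite !inE.
Qed.

Lemma double_deletion_families n (C : code k n.+1) e g :
  g \in shattered_families (double_deletion C e) ->
  fcons (Some e) g \in shattered_families C.
Proof.
rewrite !inE => /asboolP shg; apply/asboolP => e'.
apply/shattersP => f fe; have /shattersP := shg e'.
case/(_ (fun x => f (lift ord0 x))) => [x|c].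
  by rewrite inE => gx; apply: fe; rewrite inE fconsS.
rewrite inE => /andP[c1 c2] cf.
(* The new coordinate lies in the set of [e'] only if [e = e']; then [f] asks there for one of the
   two available letters, and otherwise either letter will do. *)
have [a aC af] : exists2 a, fcons a c \in C & e = e' -> a = f ord0.
  have [ee'|ne] := eqVneq e e'; last first.
    by exists (val e).1 => // ee'; rewrite ee' eqxx in ne.
  have := fe ord0; rewrite !inE fcons0 -ee' eqxx => /(_ isT) /orP[] /eqP f0.
    by exists (val e).1 => //; rewrite f0.
  by exists (val e).2 => //; rewrite f0.
exists (fcons a c) => // x.
rewrite !inE; case: (unliftP ord0 x) => [y|] ->.
  by rewrite !fconsS => gy; apply: cf; rewrite !inE.
by rewrite !fcons0 => /eqP[].
Qed.

Lemma card_code_leq_families n (C : code k n) : #|C| <= #|shattered_families C|.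
Proof.
elim: n C => [|n IHn] C.
  have [->|[c cC]] := set_0Vmem C; first by rewrite cards0.
  apply: (@leq_trans 1).
    by apply: leq_trans (max_card _) _; rewrite card_ffun !card_ord expn0.
  rewrite card_gt0; apply/set0Pn.
  exists [ffun => None]; rewrite inE; apply/asboolP => e; apply/shattersP => f _.
  by exists c => // -[].
rewrite [leqRHS]card_fcons [X in _ <= X](bigD1 None) //=.
apply: leq_trans (leq_card_deletion _ C) _; apply: leq_add.
  apply: leq_trans (IHn _) _; rewrite -sum1_card big_mkcond.
  by apply: leq_sum => g _; case: ifP => // /deletion_families ->.
rewrite (reindex_omap Some id) /=; last by case.
under [leqRHS]eq_bigl do rewrite eqxx.
apply: leq_sum => e _.
apply: leq_trans (IHn _) _; rewrite -sum1_card big_mkcond.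
by apply: leq_sum => g _; case: ifP => // /double_deletion_families ->.
Qed.

(** Shattering passes to subsets, so a larger set would contain a shattered one of size exactly
    [s e]. *)
Lemma shattered_families_lt n (C : code k n) s g e :
  shatter_free s C -> g \in shattered_families C ->
  #|g @^-1: [set Some e]| < s e.
Proof.
move=> Cfree; rewrite inE => /asboolP shg; rewrite ltnNge; apply/negP => le_s.
have [S SA Scard] : exists2 S : {set 'I_n},
    S \subset g @^-1: [set Some e] & #|S| = s e.
  exists [set x in take (s e) (enum (g @^-1: [set Some e]))].
    by apply/fintype.subsetP => x; rewrite inE => /mem_take; rewrite mem_enum.
  rewrite cardsE; have /card_uniqP -> : uniq (take (s e) (enum (g @^-1: [set Some e]))).
    exact/take_uniq/enum_uniq.
  by rewrite size_takel // -cardE.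
apply: (Cfree e S Scard); apply/shattersP => f fe.
have /shattersP := shg e.
case/(_ (fun x => if x \in S then f x else (val e).1)) => [x _|c cC cf].
  by case: ifP => [/fe //|_]; rewrite !inE eqxx.
by exists c => // x xS; rewrite cf ?xS // (fintype.subsetP SA).
Qed.

End PairShattering.

(** * Counting families by their sizes *)

Lemma prod_option (T : finType) (F : option T -> nat) :
  \prod_u F u = (\prod_t F (Some t)) * F None.
Proof.
rewrite (bigD1 None) //= mulnC (reindex_omap Some id) /=; last by case.
by congr muln; apply: eq_bigl => t; rewrite eqxx.
Qed.

(** Only the last entry can be negative, so the sign test becomes a comparison in [nat]. *)
Lemma multinomial_rcons k (s : pairs k -> nat) n
    (alpha : {dffun forall e : pairs k, 'I_(s e)}) :
  multinomial n (rcons [seq Posz (alpha e) | e : pairs k]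
             (Posz n - \sum_(e : pairs k) Posz (alpha e))%R)
  = if \sum_e alpha e <= n then
      n`! %/ ((\prod_e (alpha e)`!) * (n - \sum_e alpha e)`!)
    else 0.
Proof.
rewrite /multinomial.
have -> : (\sum_(e : pairs k) Posz (alpha e))%R = Posz (\sum_e alpha e).
  by rewrite (big_morph Posz PoszD (erefl _)).
rewrite all_rcons subr_ge0 lez_nat; case: leqP => //= le_n.
rewrite all_map (eq_all (a2 := predT)) // all_predT.
rewrite big_rcons big_map subzn // big_enum /=.
by congr (_ %/ (_ * _)); apply: eq_bigl.
Qed.

Lemma card_shatter_free n k (s : pairs k -> nat) (C : code k n) :
  shatter_free s C -> #|C| <= multinomial_bound s n.
Proof.
move=> Cfree; apply: leq_trans (card_code_leq_families _ C) _.
pose A := shattered_families C.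
rewrite /multinomial_bound -/A -sum1_card.
have [->|[g0 g0A]] := set_0Vmem A; first by rewrite big_set0.
have s_gt0 e : 0 < s e.
  exact: leq_ltn_trans (shattered_families_lt _ _ _ _ e Cfree g0A).
(* The default of [insubd] is never reached on [A], by [shattered_families_lt]. *)
pose ord_of (g : {ffun 'I_n -> option (pairs k)}) e : 'I_(s e) :=
  insubd (Ordinal (s_gt0 e)) #|g @^-1: [set Some e]|.
pose type (g : {ffun 'I_n -> option (pairs k)}) :
  {dffun forall e : pairs k, 'I_(s e)} := [ffun e => ord_of g e].
have typeE g e : g \in A -> type g e = #|g @^-1: [set Some e]| :> nat.
  by move=> gA; rewrite ffunE /ord_of val_insubd
    (shattered_families_lt _ _ _ _ _ Cfree).
rewrite (partition_big type xpredT) //=; apply: leq_sum => alpha _.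
rewrite multinomial_rcons.
(* The fiber over [None] holds the coordinates outside every set of the family. *)
pose a u := if u is Some e then val (alpha e) else n - \sum_e alpha e.
have sum_fibers g : g \in A -> type g = alpha ->
    \sum_e alpha e + #|g @^-1: [set None]| = n.
  move=> gA <-; rewrite -[RHS]card_ord -[RHS]sum1_card (partition_big g xpredT) //=.
  rewrite [RHS](bigD1 None) //= addnC; congr addn.
    by rewrite -sum1_card; apply: eq_bigl => x; rewrite !inE.
  rewrite (reindex_omap Some id) /=; last by case.
  under [RHS]eq_bigl do rewrite eqxx.
  apply: eq_bigr => e _; rewrite typeE // -sum1_card.
  by apply: eq_bigl => x; rewrite !inE.
rewrite sum1dep_card.
set B := [set _ | _]; have [->|[g1]] := set_0Vmem B; first by rewrite cards0.
rewrite inE => /andP[g1A /eqP tg1].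
rewrite ifT; last by rewrite -[leqRHS](sum_fibers _ g1A tg1) leq_addr.
rewrite leq_divRL; last first.
  by rewrite muln_gt0 fact_gt0 andbT prodn_gt0 // => e; exact: fact_gt0.
apply: leq_trans (card_fibers_fact _ n a); rewrite prod_option /= leq_mul2r.
apply/orP; right; apply/subset_leq_card/fintype.subsetP => g.
rewrite [g \in B]inE => /andP[gA /eqP tg]; rewrite inE.
apply/forallP => -[e|] /=; apply/eqP.
  by rewrite -tg; exact/esym/typeE.
by rewrite -[X in _ = X - _](sum_fibers _ gA tg) addKn.
Qed.

(** Dropping the factorials of the [alpha e] from a denominator leaves a falling factorial of [n]
    with at most [\sum_e (s e - 1)] factors. *)
Lemma multinomial_bound_leq k (s : pairs k -> nat) n :
  0 < n ->
  multinomial_bound s n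
    <= #|{dffun forall e : pairs k, 'I_(s e)}| * n ^ (\sum_e (s e - 1)).
Proof.
move=> n_gt0; rewrite -sum_nat_const; apply: leq_sum => alpha _.
rewrite multinomial_rcons; case: ifP => // le_n.
pose b := \sum_e nat_of_ord (alpha e); rewrite -/b in le_n *.
have b_le : b <= \sum_e (s e - 1).
  by apply: leq_sum => e _; have := ltn_ord (alpha e); lia.
apply: (@leq_trans (n ^ b)); last by rewrite leq_pexp2l.
apply: (@leq_trans (n`! %/ (n - b)`!)).
  apply: leq_div2l; rewrite ?fact_gt0 // leq_pmull // prodn_gt0 // => e.
  by rewrite fact_gt0.
rewrite -ffact_factd // ffact_prod -[X in n ^ X]card_ord -prod_nat_const.
by apply: leq_prod => i _; exact: leq_subr.
Qed.

(** * Lower bound: the slot code *)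

Section Construction.
Context {k : nat} (s : pairs k -> nat) (a0 : 'I_k).

Let slot : finType := {e : pairs k & 'I_(s e - 1)}.
Let q : nat := #|slot|.+1.

Lemma card_slot : #|slot| = \sum_e (s e - 1).
Proof.
rewrite card_tagged sumnE big_map big_enum.
by apply: eq_big => // e; rewrite card_ord.
Qed.

(* The residue of [x] modulo [q] is read as a slot, the quotient as a position
   inside that slot; the residue [q - 1] is used for no slot. *)
Definition slot_of (x : nat) : option slot :=
  [pick l : slot | enum_rank l == x %% q :> nat].

Definition word n (u : {ffun slot -> 'I_(n %/ q)}) : {ffun 'I_n -> 'I_k} :=
  [ffun x : 'I_n => if slot_of x is Some l then
     if x %/ q == u l then (val (tag l)).2 else (val (tag l)).1 else a0].

Definition slot_code n : code k n :=
  [set word n u | u : {ffun slot -> 'I_(n %/ q)}].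

Lemma slot_ofP x l : slot_of x = Some l -> x %% q = enum_rank l.
Proof. by rewrite /slot_of; case: pickP => // l' /eqP <- [->]. Qed.

Lemma slot_of_rank x l : x %% q = enum_rank l -> slot_of x = Some l.
Proof.
move=> xl; rewrite /slot_of; case: pickP => [l' /eqP|/(_ l)].
  by rewrite xl => /val_inj/enum_rank_inj ->.
by rewrite xl eqxx.
Qed.

Lemma pair_neq (e : pairs k) : (val e).1 != (val e).2.
Proof. by case: e => -[i j] /= ij; rewrite -val_eqE neq_ltn ij. Qed.

Lemma word_inj n : injective (@word n).
Proof.
move=> u v /ffunP uv; apply/ffunP => l; apply: val_inj => /=.
have lt_l : enum_rank l < q by apply: leq_trans (ltn_ord _) (leqnSn _).
(* This coordinate is position [u l] of slot [l], where [word u] shows the second letter; [word v]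
   does so only if [v l = u l]. *)
have lt_n : u l * q + enum_rank l < n.
  apply: (@leq_trans ((u l).+1 * q)); first by rewrite mulSn addnC ltn_add2r.
  apply: leq_trans (leq_divM n q); rewrite leq_mul2r; apply/orP; right.
  exact: ltn_ord.
have := uv (Ordinal lt_n); rewrite !ffunE /=.
rewrite (@slot_of_rank _ l); last by rewrite modnMDl modn_small.
rewrite divnMDl // (divn_small lt_l) addn0 eqxx; case: eqP => // _ /eqP.
by rewrite eq_sym (negPf (pair_neq _)).
Qed.

Lemma card_slot_code n : #|slot_code n| = (n %/ q) ^ #|slot|.
Proof.
by rewrite card_imset ?cardsT ?card_ffun ?card_ord //; exact: word_inj.
Qed.

Lemma slot_code_shatter_free n :
  (forall e, 0 < s e) -> shatter_free s (slot_code n).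
Proof.
move=> s_gt0 e S cardS /shattersP shS.
have ne12 := negPf (pair_neq e).
(* The two constant patterns make [x] take both letters of [e], so [x] lies in a slot whose pair has
   the same letters; their order excludes a swap. *)
have slotS x : x \in S -> exists2 l, slot_of x = Some l & tag l = e.
  move=> xS.
  have [|c1 /imsetP[u1 _ ->] /(_ x xS)] := shS (fun=> (val e).1).
    by move=> *; rewrite !inE eqxx.
  have [|c2 /imsetP[u2 _ ->] /(_ x xS)] := shS (fun=> (val e).2).
    by move=> *; rewrite !inE eqxx orbT.
  rewrite !ffunE; case: (slot_of x) => [l|]; last first.
    by move=> -> /eqP; rewrite eq_sym ne12.
  move=> w2 w1; exists l => //; apply: val_inj.
  have := valP e; have := valP (tag l); move: w1 w2 ne12.
  rewrite [val (tag l)]surjective_pairing [val e]surjective_pairing /=.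
  case: ifP => _ <-; case: ifP => _ <- //=; rewrite ?eqxx //.
  by move=> _ lt1 lt2; have := ltn_trans lt1 lt2; rewrite ltnn.
(* In a word matching this pattern each point of [S] is the chosen position of its slot, so distinct
   points have distinct slots. *)
have [|c /imsetP[u _ ->] cS] := shS (fun=> (val e).2).
  by move=> *; rewrite !inE eqxx orbT.
pose slot_nat (x : 'I_n) : nat :=
  odflt 0 (omap (fun l : slot => nat_of_ord (tagged l)) (slot_of x)).
have slot_lt x : x \in S -> slot_nat x < s e - 1.
  by move=> /slotS[l xl <-]; rewrite /slot_nat xl /=; exact: ltn_ord.
have posE x l : x \in S -> slot_of x = Some l -> x %/ q = u l.
  move=> xS xl; have := cS x xS; have [l' xl' le] := slotS x xS.
  have ll' : l = l' by apply: Some_inj; rewrite -xl -xl'.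
  rewrite ffunE xl ll' le; case: eqP => // _ /eqP.
  by rewrite ne12.
have slot_inj : {in S &, injective slot_nat}.
  move=> x y xS yS.
  have [l xl le] := slotS x xS; have [l' yl le'] := slotS y yS.
  rewrite /slot_nat xl yl /=.
  move=> eq_ll'; have ll' : l = l'.
    case: l l' le le' eq_ll' {xl yl} => [e1 i] [e2 j] /= E1 E2.
    by subst e1 e2 => /val_inj ->.
  apply: val_inj; rewrite /= (divn_eq x q) (divn_eq y q).
  by rewrite (posE _ _ xS xl) (posE _ _ yS yl) (slot_ofP _ _ xl) (slot_ofP _ _ yl) ll'.
have : #|S| <= s e - 1.
  rewrite cardE -(size_map slot_nat) -[leqRHS](size_iota 0).
  apply: uniq_leq_size => [|_ /mapP[x xS ->]].
    rewrite map_inj_in_uniq ?enum_uniq // => x y; rewrite !mem_enum.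
    exact: slot_inj.
  by rewrite mem_iota slot_lt // -mem_enum.
by rewrite cardS leqNgt; have := s_gt0 e; lia.
Qed.

(** The quotient is positive, so rounding loses less than a factor 2: [n < 2 * q * (n %/ q)]. *)
Lemma slot_code_lower_bound n : q <= n ->
  n ^ #|slot| <= (2 * q) ^ #|slot| * #|slot_code n|.
Proof.
move=> le_qn; rewrite card_slot_code -expnMn.
case: (posnP #|slot|) => [->//|slot_gt0]; rewrite leq_exp2r //.
have := divn_eq n q; have : n %% q < q by rewrite ltn_mod.
have : 0 < n %/ q by rewrite divn_gt0.
by nia.
Qed.

End Construction.

(** * Asymptotic form of both bounds *)

Local Open Scope classical_set_scope.
Local Open Scope ring_scope.

Theorem theorem6 (R : realType) (k : nat) (s : pairs k -> nat) (p : nat)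
    (hk : (2 <= k)%N)
    (hs : forall e : pairs k, (0 < s e)%N)
    (hp : p = (\sum_(e : pairs k) (s e - 1))%N) :
  ((forall (n : nat) (C : code k n), (1 <= n)%N -> shatter_free s C ->
      (#|C| <= multinomial_bound s n)%N) /\
   (fun n : nat => (multinomial_bound s n)%:R : R^o)
     =O_\oo (fun n : nat => n%:R ^+ p : R^o)) /\
  (exists C : forall n : nat, code k n,
    (forall n : nat, shatter_free s (C n)) /\
    (fun n : nat => #|C n|%:R : R^o)
      =Omega_\oo (fun n : nat => n%:R ^+ p : R^o)).
Proof.
split; [split|].
- by move=> n C _; exact: card_shatter_free.
- apply/eqO_exP; pose K := #|{dffun forall e : pairs k, 'I_(s e)}|.
  exists K.+1%:R; first by rewrite ltr0n.
  exists 1%N => // n /= n_gt0.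
  rewrite -natrX !normr_nat -natrM ler_nat hp.
  apply: leq_trans (multinomial_bound_leq _ _ _ n_gt0) _.
  by rewrite leq_mul2r leqnSn orbT.
pose a0 : 'I_k := Ordinal (ltnW hk).
exists (slot_code s a0); split; first by move=> n; exact: slot_code_shatter_free.
(* The roles are exchanged: [n ^ p] is to be bounded by a constant times the size of the code. The
   constant comes from [slot_code_lower_bound] with modulus [p.+1]. *)
rewrite eqOmegaE eqOmegaO; apply/eqO_exP.
exists (((2 * p.+1) ^ p)%N)%:R; first by rewrite ltr0n expn_gt0.
exists p.+1 => // n /= le_pn.
rewrite -natrX !normr_nat -natrM ler_nat.
have p_slot : p = #|{: {e : pairs k & 'I_(s e - 1)}}| by rewrite card_slot.
by rewrite p_slot; apply: slot_code_lower_bound; rewrite -p_slot.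
Qed.
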